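(* For any positive integer $n$, $$\sum_{k=0}^{n-1}\left(-\frac{1}{8}\right)^k\sum_{j=0}^k\binom{2j}{j}\binom{2k-2j}{k-j}(6j+1)(6k-6j+1)=\left(-\frac{1}{2}\right)^n n(1-3n),$$ and $$\sum_{k=0}^{n-1}\left(\frac{1}{4}\right)^k\sum_{j=0}^k\binom{2j}{j}\binom{2k-2j}{k-j}(6j+1)(6k-6j+1)=\frac{n(3n^2-3n+2)}{2}.$$
   Context: $\binom{a}{b}$ denotes the ordinary binomial coefficient; the identities are between rational numbers. *)

(* Defs.v *)
From mathcomp Require Export all_boot all_order all_algebra.

Set Implicit Arguments.
Unset Strict Implicit.
Unset Printing Implicit Defensive.

(* Main.v *)
Require Import Defs.
From mathcomp Require Import all_boot all_order all_algebra.
From mathcomp Require Import ring zify.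

Import Order.TTheory GRing.Theory Num.Theory.
Local Open Scope ring_scope.

(** Write a_j for the central binomial coefficient. The inner sum is the
    coefficient of x^k in the square of
      sum_j (6j+1) a_j x^j = (1 + 8x) (1 - 4x)^(-3/2),
    that is in (1 + 8x)^2 / (1 - 4x)^3, so it must equal
    4^k (9k^2 + 3k + 2) / 2 ([cbin_conv_linear]). After that evaluation both
    outer sums have a polynomial times a power of -1/2 or of 1 as summand, and
    they telescope.

    The evaluation needs no power series. Since
      (6j+1)(6(k-j)+1) = 36 j(k-j) + 6k + 1,
    it suffices to know the sums over j of a_j a_(k-j) and of
    j(k-j) a_j a_(k-j). Both satisfy first-order recurrences in k, for two
    reasons. The recurrence (j+1) a_(j+1) = (4j+2) a_j, which is the
    differential equation (1 - 4x) A' = 2A of the generating function, turns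
    a convolution of order k+1 carrying a factor j into one of order k
    ([cbin_conv_shift]). The reflection j <-> k-j replaces a factor j by its
    mean value k/2 ([conv_mean]), so that the resulting sums are again among
    the two under study. *)

Definition cbin (j : nat) : rat := 'C(2 * j, j)%:R.

Lemma cbin_rec j : j.+1%:R * cbin j.+1 = (4 * j%:R + 2) * cbin j.
Proof.
have eq1 := mul_bin_diag (2 * j).+2 j.
have eq2 := mul_bin_diag (2 * j).+1 j.
(* the two middle coefficients of the odd row 2j+1 are equal *)
have sym : 'C((2 * j).+1, j) = 'C((2 * j).+1, j.+1).
  by rewrite -bin_sub; [congr 'C(_, _); lia | lia].
rewrite /cbin -natrM -[4]/(4%:R) -[2 in X in _ = X]/(2%:R) -natrM -natrD -natrM.
congr _%:R; rewrite /= in eq1 eq2.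
rewrite (_ : 2 * j.+1 = (2 * j).+2)%N; last lia.
by rewrite -eq1 sym; nia.
Qed.

(** The term j = 0 vanishes because of the weight, and every other term is
    lowered by one with [cbin_rec]. *)
Lemma cbin_conv_shift (g : nat -> rat) k :
  \sum_(j < k.+2) j%:R * cbin j * g (k.+1 - j)%N =
  \sum_(j < k.+1) (4 * j%:R + 2) * cbin j * g (k - j)%N.
Proof.
rewrite big_ord_recl !mul0r add0r.
by apply: eq_bigr => j _; rewrite lift0 subSS cbin_rec.
Qed.

(** In the convolution of f with itself the index j has mean value k/2, by the
    symmetry j <-> k-j. *)
Lemma conv_mean (f : nat -> rat) k :
  2 * \sum_(j < k.+1) j%:R * f j * f (k - j)%N =
  k%:R * \sum_(j < k.+1) f j * f (k - j)%N.
Proof.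
rewrite mulrDl !mul1r {2}(reindex_inj rev_ord_inj) -big_split mulr_sumr /=.
apply: eq_bigr => j _; have le_jk : (j <= k)%N by rewrite -ltnS.
by rewrite subSS subKn // natrB //; ring.
Qed.

Lemma cbin_conv k : \sum_(j < k.+1) cbin j * cbin (k - j)%N = 4 ^+ k.
Proof.
elim: k => [|k IHk]; first by rewrite big_ord1.
have eqk1 := conv_mean cbin k.+1.
rewrite cbin_conv_shift in eqk1.
have split_sum : \sum_(j < k.+1) (4 * j%:R + 2) * cbin j * cbin (k - j)%N =
    2 * (2 * \sum_(j < k.+1) j%:R * cbin j * cbin (k - j)%N)
    + 2 * \sum_(j < k.+1) cbin j * cbin (k - j)%N.
  by rewrite !mulr_sumr -big_split; apply: eq_bigr => j _ /=; ring.
have k1_neq0 : k.+1%:R != 0 :> rat by rewrite pnatr_eq0.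
apply: (mulfI k1_neq0); rewrite -eqk1 split_sum conv_mean IHk.
by rewrite exprS -natr1; ring.
Qed.

(** Only one of the two factors of the weight j(k-j) is used to lower the order
    of the convolution; the other one rides along inside g. *)
Lemma cbin_conv_mul k :
  \sum_(j < k.+1) j%:R * cbin j * ((k - j)%:R * cbin (k - j)%N) =
  4 ^+ k * (k%:R * (k%:R - 1) / 8).
Proof.
elim: k => [|k IHk]; first by rewrite big_ord1 !mul0r mulr0.
rewrite (cbin_conv_shift (fun m => m%:R * cbin m)).
have split_sum :
    \sum_(j < k.+1) (4 * j%:R + 2) * cbin j * ((k - j)%:R * cbin (k - j)%N) =
    4 * (\sum_(j < k.+1) j%:R * cbin j * ((k - j)%:R * cbin (k - j)%N))
    + (2 * k%:R * (\sum_(j < k.+1) cbin j * cbin (k - j)%N)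
       - 2 * \sum_(j < k.+1) j%:R * cbin j * cbin (k - j)%N).
  rewrite !mulr_sumr -sumrB -big_split.
  apply: eq_bigr => j _ /=; have le_jk : (j <= k)%N by rewrite -ltnS.
  by rewrite natrB //; ring.
rewrite split_sum IHk conv_mean cbin_conv exprS -natr1.
by field.
Qed.

(** The right-hand side is the coefficient of x^k in (1 + 8x)^2 / (1 - 4x)^3.
    The linear part of the expanded weight depends on k only, because the two
    indices add up to k. *)
Lemma cbin_conv_linear k :
  \sum_(0 <= j < k.+1) 'C(2 * j, j)%:R * 'C(2 * k - 2 * j, k - j)%:R
    * (6 * j%:R + 1) * (6 * k%:R - 6 * j%:R + 1) =
  4 ^+ k * ((9 * k%:R ^+ 2 + 3 * k%:R + 2) / 2) :> rat.
Proof.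
rewrite big_mkord.
transitivity
  (36 * (\sum_(j < k.+1) j%:R * cbin j * ((k - j)%:R * cbin (k - j)%N))
   + (6 * k%:R + 1) * \sum_(j < k.+1) cbin j * cbin (k - j)%N).
  rewrite !mulr_sumr -big_split; apply: eq_bigr => j _ /=.
  have le_jk : (j <= k)%N by rewrite -ltnS.
  by rewrite /cbin -mulnBr natrB //; ring.
by rewrite cbin_conv_mul cbin_conv; field.
Qed.

Theorem corollary1p3 (n : nat) (n_gt0 : (0 < n)%N) :
  (\sum_(0 <= k < n) (- (1 / 8)) ^+ k *
     (\sum_(0 <= j < k.+1)
        'C(2 * j, j)%:R * 'C(2 * k - 2 * j, k - j)%:R
        * (6 * j%:R + 1) * (6 * k%:R - 6 * j%:R + 1))
   = (- (1 / 2)) ^+ n * n%:R * (1 - 3 * n%:R) :> rat)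
  /\
  (\sum_(0 <= k < n) (1 / 4) ^+ k *
     (\sum_(0 <= j < k.+1)
        'C(2 * j, j)%:R * 'C(2 * k - 2 * j, k - j)%:R
        * (6 * j%:R + 1) * (6 * k%:R - 6 * j%:R + 1))
   = n%:R * (3 * n%:R ^+ 2 - 3 * n%:R + 2) / 2 :> rat).
Proof.
(* both right-hand sides vanish at n = 0, so the induction can start there *)
clear n_gt0; split; elim: n => [|n IHn].
- by rewrite big_nil mulr0 mul0r.
- rewrite big_nat_recr //= cbin_conv_linear [X in _ + X]mulrA -exprMn IHn (exprS _ n)
          -[n.+1%:R]natr1.
  by rewrite (_ : - (1 / 8) * 4 = - (1 / 2)) //; field.
- by rewrite big_nil !mul0r.
- rewrite big_nat_recr //= cbin_conv_linear [X in _ + X]mulrA -exprMn IHn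
          -[n.+1%:R]natr1.
  by rewrite (_ : 1 / 4 * 4 = 1) // expr1n; field.
Qed.
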